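(* Let $E$ be a locally complete locally convex Hausdorff space over $\mathbb{K}$ ($\mathbb{K}=\mathbb{R}$ or $\mathbb{C}$), $\Omega\subset\mathbb{R}^{2}$ open, $[a,b]\times[c,d]\subset\Omega$ and $f\colon\Omega\to E$ weakly $\mathcal{C}^{1}$. Then $f$ is Pettis-integrable on $[a,b]\times[c,d]$ and \[ \int_{[a,b]\times[c,d]}f(x_1,x_2)\,\mathrm{d}(x_1,x_2)=\int_{[c,d]}\int_{[a,b]}f(x_1,x_2)\,\mathrm{d}x_1\,\mathrm{d}x_2=\int_{[a,b]}\int_{[c,d]}f(x_1,x_2)\,\mathrm{d}x_2\,\mathrm{d}x_1, \] where all integrals (including the inner and outer iterated ones) exist as Pettis-integrals in $E$.
   Context: $E$ is a non-trivial locally convex Hausdorff space with dual $E'$. For a bounded, absolutely convex set (disk) $D\subset E$ put $E_D:=\bigcup_{n\in\mathbb{N}}nD$ normed by the gauge of $D$; $E$ is locally complete if $E_D$ is a Banach space for every closed disk $D$. $f\colon\Omega\to E$ is weakly $\mathcal{C}^1$ if $e'\circ f\colon\Omega\to\mathbb{K}$ is continuously partially differentiable for every $e'\in E'$. A function $h$ with values in $E$ is Pettis-integrable on a Lebesgue measurable set $\Lambda$ if $e'\circ h$ is Lebesgue integrable on $\Lambda$ for every $e'\in E'$ and there is $e_\Lambda(h)\in E$ with $\langle e',e_\Lambda(h)\rangle=\int_\Lambda\langle e',h(x)\rangle\,\mathrm{d}x$ for all $e'\in E'$; then $\int_\Lambda h(x)\,\mathrm{d}x:=e_\Lambda(h)$.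 *)

(* Defs.v *)
From HB Require Import structures.
From mathcomp Require Import all_boot all_order all_algebra.
From mathcomp Require Import complex.
From mathcomp Require Import all_classical all_reals all_analysis.

Set Implicit Arguments.
Unset Strict Implicit.
Unset Printing Implicit Defensive.

Import Order.TTheory GRing.Theory Num.Theory.
Import numFieldNormedType.Exports.

Local Open Scope classical_set_scope.
Local Open Scope ring_scope.

(* The two possible scalar fields, R itself and R[i]. *)
Variant scalar_kind := RealScalars | ComplexScalars.

Definition scalar_field (R : realType) (k : scalar_kind) : numFieldType :=
  match k with
  | RealScalars => R
  | ComplexScalars => R[i]
  end.

Definition scalar_of_real (R : realType) (k : scalar_kind) :
    R -> scalar_field R k :=
  match k with
  | RealScalars => fun x => x
  | ComplexScalars => fun x => (x%:C)%C
  end.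
Arguments scalar_of_real {R} k.

Section scalar_integration.
Context d (T : measurableType d) (R : realType).
Variable mu : {measure set T -> \bar R}.

Definition scalar_integrable (k : scalar_kind) (A : set T) :
    (T -> scalar_field R k) -> Prop :=
  match k with
  | RealScalars => fun g => mu.-integrable A (EFin \o g)
  | ComplexScalars => fun g =>
      mu.-integrable A (fun x => (complex.Re (g x))%:E) /\
      mu.-integrable A (fun x => (complex.Im (g x))%:E)
  end.

Definition scalar_integral (k : scalar_kind) (A : set T) :
    (T -> scalar_field R k) -> scalar_field R k :=
  match k with
  | RealScalars => fun g => \int[mu]_(x in A) g x
  | ComplexScalars => fun g =>
      ((\int[mu]_(x in A) complex.Re (g x)) +i*
       (\int[mu]_(x in A) complex.Im (g x)))%C
  end.

End scalar_integration.

Section locally_complete.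
Context (R : realType) (k : scalar_kind).
Notation K := (scalar_field R k).
Context (E : tvsType K).
Implicit Types D : set E.

Definition absolutely_convex D := forall (a b : K) (x y : E),
  `|a| + `|b| <= 1 -> D x -> D y -> D (a *: x + b *: y).

Definition tvs_bounded D := forall U : set E, nbhs 0 U ->
  exists2 r : R, 0 < r & D `<=` [set scalar_of_real k r *: x | x in U].

Definition is_disk D := [/\ D !=set0, absolutely_convex D & tvs_bounded D].

Definition disk_span D : set E := \bigcup_n [set n%:R *: x | x in D].

Definition disk_gauge D (x : E) : R :=
  inf [set t : R | 0 < t /\ [set scalar_of_real k t *: y | y in D] x].

(* [disk_span D] with the norm [disk_gauge D] is presented by an isometric
   linear bijection from a Banach space of the library. *)
Definition disk_banach D := exists (X : completeNormedModType K)
    (j : {linear X -> E}),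
  [/\ injective j, range j = disk_span D &
      forall x : X, `|x| = scalar_of_real k (disk_gauge D (j x))].

Definition locally_complete := forall D, is_disk D -> closed D -> disk_banach D.

End locally_complete.

Arguments locally_complete {R k} E.

Section weakly_C1.
Context (R : realType) (k : scalar_kind).
Notation K := (scalar_field R k).

(* Partial derivatives are taken in real directions also when K = R[i], where
   the library's [derivable] does not apply: R[i] is only normed over R[i]. *)
Definition is_partial1 (g : R * R -> K) (p : R * R) (l : K) :=
  (scalar_of_real k h)^-1 * (g (p.1 + h, p.2) - g p) @[h --> (0 : R)^'] --> l.

Definition is_partial2 (g : R * R -> K) (p : R * R) (l : K) :=
  (scalar_of_real k h)^-1 * (g (p.1, p.2 + h) - g p) @[h --> (0 : R)^'] --> l.

Definition continuously_partially_differentiable (Omega : set (R * R))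
    (g : R * R -> K) := exists g1 g2 : R * R -> K,
  [/\ forall p, Omega p -> is_partial1 g p (g1 p) /\ is_partial2 g p (g2 p),
      {within Omega, continuous g1} & {within Omega, continuous g2}].

Definition weakly_C1 (E : tvsType K) (Omega : set (R * R)) (f : R * R -> E) :=
  forall e' : {linear E -> K^o}, continuous e' ->
    continuously_partially_differentiable Omega (fun p => e' (f p)).

End weakly_C1.

Section pettis.
Context (R : realType) (k : scalar_kind).
Notation K := (scalar_field R k).
Context (E : tvsType K) d (T : measurableType d).
Variable mu : {measure set T -> \bar R}.
Implicit Types (A : set T) (h : T -> E).

Definition is_pettis_integral A h (v : E) :=
  forall e' : {linear E -> K^o}, continuous e' ->
    e' v = scalar_integral mu A (fun x => e' (h x)).

Definition pettis_integrable A h :=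
  (forall e' : {linear E -> K^o}, continuous e' ->
     scalar_integrable mu A (fun x => e' (h x))) /\
  exists v : E, is_pettis_integral A h v.

(* The vector is unique when E is Hausdorff, by Hahn-Banach; the value is 0
   by convention when there is none. *)
Definition pettis_integral A h : E := xget 0 (is_pettis_integral A h).

End pettis.

(* Main.v *)
Require Import Defs.
From HB Require Import structures.
From mathcomp Require Import all_boot all_order all_algebra.
From mathcomp Require Import complex.
From mathcomp Require Import all_classical all_reals all_analysis.
From mathcomp Require Import measurable_realfun.
From mathcomp Require Import ring lra.

Set Implicit Arguments.
Unset Strict Implicit.
Unset Printing Implicit Defensive.

Import Order.TTheory GRing.Theory Num.Theory.
Import numFieldNormedType.Exports.

Local Open Scope classical_set_scope.
Local Open Scope ring_scope.

(** A weakly C^1 function is weakly Lipschitz on the rectangle: each scalar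
    function [e' \o f] has bounded partial derivatives there, and two points on
    a horizontal or vertical segment of the rectangle can be compared by the
    mean value theorem ([C1_lipschitz]). No more regularity is used.

    In one variable, a weakly Lipschitz [h : [a, b] -> E] is Pettis-integrable
    ([pettis_integrable_lipschitz]). For a continuous functional the Riemann
    sum of [h] with [n] nodes differs from the integral by O(1/n)
    ([riemann_sum_error]), so the Riemann sums [s n] satisfy
    [|phi (s n - s m)| <= M (1/n + 1/m)] with [M] depending on the functional
    [phi]. Put differently, the quotients [(s n - s m) / (1/n + 1/m)] are weakly
    bounded, and so is their bipolar [cauchy_disk s], a closed disk. Weakly
    bounded sets are bounded (Mackey, [weakly_bounded_bounded]), hence local
    completeness makes the span of this disk a Banach space. There [s - s 0] is
    a Cauchy sequence, and on that space every functional is bounded, so the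
    limit has the required weak integrals ([weakly_fast_cauchy_cvg]).

    Two variables follow by iteration ([pettis_iterated]). The inner integral is
    weakly Lipschitz in the remaining variable, hence Pettis-integrable, and the
    scalar theorem of Fubini identifies the functionals of the two iterated
    integrals with the integral of [phi \o f] over the rectangle
    ([lipschitz_rectangle_fubini]). So either iterated integral is a Pettis
    integral over the rectangle, and since functionals separate the points of a
    Hausdorff space ([real_functional_separates]), all three are equal.

    Both scalar fields are treated at once through the real parts of continuous
    functionals ([real_functional]); they determine everything because the
    imaginary part of [e'] is the real part of [- 'i *: e']. The functional
    analysis behind Mackey's theorem and the separation of points is the
    theorem of Hahn and Banach ([hahn_banach]) for gauges of convex
    neighbourhoods ([gauge_seminorm]). *)

(** * Sublinear functionals and the Hahn-Banach theorem *)

Section hahn_banach.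
Context (R : realType) (V : lmodType R).
Implicit Types (p q : V -> R) (S : V -> set R) (x y z : V).

Definition sublinear p :=
  (forall x y, p (x + y) <= p x + p y) /\
  (forall r x, 0 < r -> p (r *: x) <= r * p x).

(** Tangents, infima of chains and gauges are all infima of sets [S x] of
    admissible values that are compatible with the linear structure. *)
Lemma inf_sublinear S :
  (forall x, S x !=set0) -> (forall x, has_lbound (S x)) ->
  (forall x y s t, S x s -> S y t -> exists2 u, S (x + y) u & u <= s + t) ->
  (forall r x s, 0 < r -> S x s -> exists2 u, S (r *: x) u & u <= r * s) ->
  sublinear (fun x => inf (S x)).
Proof.
move=> S0 Sb SD SZ; split=> [x y|r x r0].
  rewrite -lerBlDr; apply: lb_le_inf => // s Sxs.
  rewrite lerBlDr -lerBlDl; apply: lb_le_inf => // t Syt.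
  rewrite lerBlDl; have [u Su us] := SD _ _ _ _ Sxs Syt.
  by apply: le_trans us; exact: ge_inf.
rewrite -ler_pdivrMl//; apply: lb_le_inf => // s Sxs.
rewrite ler_pdivrMl//; have [u Su us] := SZ _ _ _ r0 Sxs.
by apply: le_trans us; exact: ge_inf.
Qed.

Lemma sublinear0 p : sublinear p -> p 0 = 0.
Proof.
move=> [_ pZ]; have := pZ 2 0 (ltr0Sn _ _); have := pZ 2^-1 0.
by rewrite !scaler0 => /(_ ltac:(lra)) h1 h2; apply/eqP; lra.
Qed.

Lemma sublinearZ p r x : sublinear p -> 0 <= r -> p (r *: x) = r * p x.
Proof.
move=> sp; rewrite le_eqVlt => /predU1P[<-|r0].
  by rewrite scale0r mul0r sublinear0.
apply/eqP; rewrite eq_le sp.2//=.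
have := sp.2 r^-1 (r *: x); rewrite invr_gt0 => /(_ r0).
by rewrite scalerA mulVf ?gt_eqF// scale1r ler_pdivlMl.
Qed.

Lemma sublinearN p x : sublinear p -> - p (- x) <= p x.
Proof.
move=> sp; have := sp.1 x (- x); rewrite subrr sublinear0//; lra.
Qed.

(** The functional [q] is the directional derivative
    [y |-> inf_(t >= 0) (p (y + t x) - t p x)]. It is strictly below [p] unless
    [p] is odd on the line through [x], so that a minimal sublinear functional
    is odd, hence linear. *)
Lemma sublinear_tangent p x : sublinear p ->
  exists q, [/\ sublinear q, forall y, q y <= p y & q (- x) <= - p x].
Proof.
move=> sp.
pose S y := [set p (y + t *: x) - t * p x | t in [set t | 0 <= t]].
have lbS y : lbound (S y) (- p (- y)).
  move=> _ [t /= t0 <-]; have := sp.1 (y + t *: x) (- y).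
  by rewrite addrAC subrr add0r sublinearZ//; lra.
exists (fun y => inf (S y)); split.
- apply: inf_sublinear.
  + by move=> y; exists (p (y + 0 *: x) - 0 * p x), 0 => /=.
  + by move=> y; exists (- p (- y)).
  + move=> y z _ _ [s /= s0 <-] [t /= t0 <-].
    exists (p (y + z + (s + t) *: x) - (s + t) * p x).
      by exists (s + t) => //=; exact: addr_ge0.
    have := sp.1 (y + s *: x) (z + t *: x).
    by rewrite scalerDl addrACA; lra.
  + move=> r y _ r0 [s /= s0 <-].
    exists (p (r *: y + (r * s) *: x) - (r * s) * p x).
      by exists (r * s) => //=; rewrite mulr_ge0// ltW.
    by rewrite -scalerA -scalerDr (sublinearZ _ sp) ?(ltW r0)// mulrBr mulrA.
- move=> y; apply: ge_inf; first by exists (- p (- y)).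
  by exists 0 => //=; rewrite scale0r addr0 mul0r subr0.
- apply: ge_inf; first by exists (- p (- - x)).
  by exists 1 => //=; rewrite scale1r addNr sublinear0// mul1r sub0r.
Qed.

(** Zorn's lemma applies because sublinear functionals below [p] are bounded
    below by [y |-> - p (- y)], and a pointwise infimum of a chain is
    sublinear. *)
Lemma minimal_sublinear p : sublinear p ->
  exists q, [/\ sublinear q, forall y, q y <= p y &
    forall q', sublinear q' -> (forall y, q' y <= q y) -> q' = q].
Proof.
move=> sp.
pose T := {q | sublinear q /\ forall y, q y <= p y}.
pose ge (q q' : T) := `[< forall y, sval q' y <= sval q y >].
have [||||[q [sq qp]] qmin] := @Zorn T ge.
- by move=> q; apply/asboolP => y.
- move=> q1 q2 q3 /asboolP h12 /asboolP h23; apply/asboolP => y.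
  exact: le_trans (h12 y).
- move=> [q1 h1] [q2 h2] /asboolP h12 /asboolP h21.
  apply: eq_exist => /=; apply/funext => y; apply/eqP.
  by rewrite eq_le h12 h21.
- move=> A Atot; have [[q0 Aq0]|A0] := pselect (A !=set0); last first.
    pose qp : T := exist _ p (conj sp (fun y => lexx _)).
    exists qp => q Aq.
    by exfalso; apply: A0; exists q.
  pose S y := [set sval q y | q in A].
  have lbS y : lbound (S y) (- p (- y)).
    move=> _ [[q [sq qp]] /= Aq <-]; apply: le_trans (sublinearN _ sq).
    by rewrite lerN2.
  have sS : sublinear (fun y => inf (S y)).
    apply: inf_sublinear.
    + by move=> y; exists (sval q0 y), q0.
    + by move=> y; exists (- p (- y)).
    + move=> y z _ _ [q1 Aq1 <-] [q2 Aq2 <-].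
      have [/asboolP h|/asboolP h] := Atot _ _ Aq1 Aq2.
        exists (sval q2 (y + z)); first by exists q2.
        by apply: le_trans ((svalP q2).1.1 _ _) _; rewrite lerD2r.
      exists (sval q1 (y + z)); first by exists q1.
      by apply: le_trans ((svalP q1).1.1 _ _) _; rewrite lerD2l.
    + move=> r y _ r0 [q Aq <-]; exists (sval q (r *: y)); first by exists q.
      exact: (svalP q).1.2.
  have Sp y : inf (S y) <= p y.
    apply: le_trans ((svalP q0).2 y); apply: ge_inf; last by exists q0.
    by exists (- p (- y)).
  pose qS : T := exist _ (fun y => inf (S y)) (conj sS Sp).
  exists qS => q Aq; apply/asboolP => y /=.
  by apply: ge_inf; [exists (- p (- y))|exists q].
- exists q; split=> // q' sq' q'q.
  have q'p y : q' y <= p y by exact: le_trans (qp y).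
  have := qmin (exist _ q' (conj sq' q'p)).
  by move=> /(_ (asboolT q'q)) /(congr1 sval).
Qed.

(** Starting from the tangent of [p] at [x] instead of [p] forces
    [phi (- x) <= - p x], that is, equality at [x]; this replaces the extension
    of a functional from the line spanned by [x]. *)
Lemma hahn_banach p x : sublinear p ->
  exists phi : V -> R, [/\ forall y z, phi (y + z) = phi y + phi z,
    forall r y, phi (r *: y) = r * phi y, forall y, phi y <= p y &
    phi x = p x].
Proof.
move=> sp; have [px [spx pxp pxx]] := sublinear_tangent x sp.
have [q [sq qpx qmin]] := minimal_sublinear spx.
have qN y : q (- y) = - q y.
  have [q' [sq' q'q q'y]] := sublinear_tangent y sq.
  apply/eqP; rewrite eq_le -{1}(qmin _ sq' q'q) q'y/=.
  have := sublinearN (- y) sq; rewrite opprK; lra.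
exists q; split.
- move=> y z; apply/eqP; rewrite eq_le sq.1/=.
  have := sq.1 (y + z) (- z); rewrite addrK qN; lra.
- move=> r y; have [r0|r0] := leP 0 r; first exact: sublinearZ.
  rewrite -[r]opprK scaleNr qN sublinearZ// ?mulNr//; lra.
- by move=> y; exact: le_trans (pxp y).
- apply/eqP; rewrite eq_le (le_trans (qpx x))//=.
  by have := qpx (- x); rewrite qN; lra.
Qed.

End hahn_banach.

(** * Real and complex scalars *)

Section scalars.
Context (R : realType) (k : scalar_kind).
Notation K := (scalar_field R k).
Local Notation "r %:K" := (scalar_of_real k r)
  (at level 2, format "r %:K").

Definition scalar_re : K -> R :=
  match k with
  | RealScalars => fun z => z
  | ComplexScalars => fun z => complex.Re z
  end.

Lemma scalar_reD (z w : K) : scalar_re (z + w) = scalar_re z + scalar_re w.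
Proof. by rewrite /scalar_re; case: k z w => // -[? ?] [? ?]. Qed.

Lemma scalar_reZ (r : R) (z : K) : scalar_re (r%:K * z) = r * scalar_re z.
Proof.
rewrite /scalar_re /scalar_of_real; case: k z => // -[x y] /=.
by rewrite mul0r subr0.
Qed.

Lemma scalar_ofK (r : R) : scalar_re r%:K = r.
Proof. by rewrite /scalar_re; case: k. Qed.

Lemma scalar_of0 : (0 : R)%:K = 0. Proof. by case: k. Qed.
Lemma scalar_of1 : (1 : R)%:K = 1. Proof. by case: k. Qed.
Lemma scalar_ofD (r s : R) : (r + s)%:K = r%:K + s%:K.
Proof. by case: k => //; exact: (rmorphD (@real_complex R)). Qed.
Lemma scalar_ofN (r : R) : (- r)%:K = - r%:K.
Proof. by case: k => //; exact: (rmorphN (@real_complex R)). Qed.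
Lemma scalar_ofM (r s : R) : (r * s)%:K = r%:K * s%:K.
Proof. by case: k => //; exact: (rmorphM (@real_complex R)). Qed.
Lemma scalar_ofV (r : R) : (r^-1)%:K = r%:K^-1.
Proof. by case: k => //; exact: (fmorphV (@real_complex R)). Qed.
Lemma scalar_of_nat (n : nat) : (n%:R : R)%:K = n%:R.
Proof. by case: k => //; exact: (rmorph_nat (@real_complex R)). Qed.

Lemma scalar_of_le (r s : R) : (r%:K <= s%:K) = (r <= s).
Proof. by case: k => //=; rewrite ?lecR. Qed.
Lemma scalar_of_lt (r s : R) : (r%:K < s%:K) = (r < s).
Proof. by case: k => //=; rewrite ?ltcR. Qed.

Lemma scalar_of_re (z : K) : 0 <= z -> (scalar_re z)%:K = z.
Proof.
rewrite /scalar_re; case: k z => // -[x y].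
by rewrite lecE /= => /andP[/eqP ->].
Qed.

Lemma scalar_norm_of (r : R) : `|r%:K| = `|r|%:K.
Proof.
case: k => //=; rewrite normc_def /=.
by rewrite expr0n/= addr0 sqrtr_sqr.
Qed.

Lemma scalar_re_norm (z : K) : `|scalar_re z|%:K <= `|z|.
Proof. by rewrite /scalar_re; case: k z => // z /=; exact: normc_ge_Re. Qed.

(** Convergence in the scalar field can be tested with real tolerances, since
    positive elements of [R[i]] are real. *)
Lemma scalar_cvgP {T} (F : set_system T) {FF : Filter F} (g : T -> K) (l : K) :
  g @ F --> l <->
  forall e : R, 0 < e -> \forall x \near F, `|l - g x| < e%:K.
Proof.
split=> [/cvgrPdist_lt gl e e0|gl].
  by apply: gl; rewrite -scalar_of0 scalar_of_lt.
apply/cvgrPdist_lt => e e0; rewrite -(scalar_of_re (ltW e0)); apply: gl.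
by rewrite -scalar_of_lt scalar_of0 scalar_of_re// ltW.
Qed.

Lemma scalar_re_cvg {T} (F : set_system T) {FF : Filter F} (g : T -> K)
    (l : K) :
  g @ F --> l -> scalar_re (g x) @[x --> F] --> scalar_re l.
Proof.
move/scalar_cvgP => gl; apply/cvgrPdist_lt => e /gl; apply: filterS => x.
rewrite -scalar_of_lt; apply: le_lt_trans.
have -> : scalar_re l - scalar_re (g x) = scalar_re (l - g x).
  apply/eqP; rewrite subr_eq -scalar_reD subrK//.
exact: scalar_re_norm.
Qed.

End scalars.
Local Notation "r %:K" := (scalar_of_real _ r) (at level 2, format "r %:K").

Section realification.
Context (R : realType) (k : scalar_kind).
Notation K := (scalar_field R k).

(** The scalars are restricted to [R] on a copy of [E], so that the two module
    structures are not confused. *)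
Definition realification (E : lmodType K) : Type := E.

Context (E : lmodType K).
HB.instance Definition _ := GRing.Zmodule.on (realification E).

Let scale (r : R) (x : realification E) : realification E := r%:K *: (x : E).
Let scaleA r s x : scale r (scale s x) = scale (r * s) x.
Proof. by rewrite /scale scalerA -scalar_ofM. Qed.
Let scale1 : left_id 1 scale.
Proof. by move=> x; rewrite /scale scalar_of1 scale1r. Qed.
Let scaleDr : right_distributive scale +%R.
Proof. by move=> r x y; rewrite /scale scalerDr. Qed.
Let scaleDl x : {morph scale^~ x : r s / r + s}.
Proof. by move=> r s; rewrite /scale scalar_ofD scalerDl. Qed.

HB.instance Definition _ := GRing.Zmodule_isLmodule.Build R (realification E)
  scaleA scale1 scaleDr scaleDl.

End realification.

(** * Real parts of continuous functionals *)

Section real_functional.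
Context (R : realType) (k : scalar_kind).
Notation K := (scalar_field R k).
Context (E : tvsType K).
Implicit Types (x y : E) (phi : E -> R).

Definition real_functional phi := exists2 e' : {linear E -> K^o},
  continuous e' & phi = (fun x => scalar_re (e' x)).

Lemma real_functionalD phi x y : real_functional phi ->
  phi (x + y) = phi x + phi y.
Proof. by move=> [e' _ ->]; rewrite raddfD scalar_reD. Qed.

Lemma real_functionalZ phi r x : real_functional phi ->
  phi (r%:K *: x) = r * phi x.
Proof. by move=> [e' _ ->]; rewrite linearZ/= scalar_reZ. Qed.

Lemma real_functional0 phi : real_functional phi -> phi 0 = 0.
Proof.
move=> rp; rewrite -[X in phi X](scale0r 0) -(scalar_of0 R).
by rewrite real_functionalZ// mul0r.
Qed.

Lemma real_functionalN phi x : real_functional phi -> phi (- x) = - phi x.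
Proof.
move=> rp; apply/eqP; rewrite -subr_eq0 opprK -real_functionalD//.
by rewrite addNr real_functional0.
Qed.

Lemma real_functionalB phi x y : real_functional phi ->
  phi (x - y) = phi x - phi y.
Proof. by move=> rp; rewrite real_functionalD// real_functionalN. Qed.

Lemma real_functional_sum phi n (F : nat -> E) : real_functional phi ->
  phi (\sum_(i < n) F i) = \sum_(i < n) phi (F i).
Proof.
move=> rp; elim: n => [|n IH]; first by rewrite !big_ord0 real_functional0.
by rewrite !big_ord_recr/= real_functionalD// IH.
Qed.

Lemma real_functional_continuous phi : real_functional phi -> continuous phi.
Proof. by move=> [e' ce' ->] x; apply: scalar_re_cvg; exact: ce'. Qed.

Lemma real_functional_rotate (u : K) phi : real_functional phi ->
  real_functional (fun x => phi (u *: x)).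
Proof.
move=> [e' ce' ->].
have l : linear (fun x => e' (u *: x) : K^o).
  move=> a x y; rewrite scalerDr scalerA mulrC -scalerA.
  by rewrite raddfD/= linearZ.
pose e'' : {linear E -> K^o} := HB.pack (fun x => e' (u *: x) : K^o)
  (GRing.isLinear.Build _ _ _ _ _ l).
exists e'' => //.
move=> x; apply: (@continuous_comp _ _ _ (fun x => u *: x) e'); last exact: ce'.
apply: (@continuous_comp _ _ _ (fun x : E => (u, x) : (K^o * E)%type)
  (fun z : (K^o * E)%type => z.1 *: z.2)); last exact: scale_continuous.
by apply: (@cvg_pair _ _ _ _ (nbhs (u : K^o))); [exact: cvg_cst|exact: cvg_id].
Qed.

End real_functional.

(** * Continuous seminorms and separation of points *)

Section continuous_seminorm.
Context (R : realType) (k : scalar_kind).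
Notation K := (scalar_field R k).
Context (E : tvsType K).
Implicit Types (x y : E) (p phi : E -> R).

Definition continuous_seminorm p :=
  [/\ sublinear (p : realification E -> R), forall x, p (- x) = p x &
      forall e, 0 < e -> nbhs 0 [set x | p x < e]].

Lemma seminorm_ge0 p x : continuous_seminorm p -> 0 <= p x.
Proof.
move=> [sp pN _]; have := sublinearN (x : realification E) sp.
by rewrite pN; lra.
Qed.

Lemma absorbing (V : set E) x : nbhs 0 V ->
  exists2 t : R, 0 < t & V (t^-1%:K *: x).
Proof.
move=> V0; have := @scale_continuous K E (0, x) V; rewrite /= scale0r.
move=> /(_ V0) [[A B] /= [A0 Bx] AB].
have [e /= e0 eA] := (nbhs_ballP (0 : K^o) A).1 A0.
exists (2 / scalar_re e).
  by rewrite divr_gt0// -(@scalar_of_lt _ k) scalar_of0 scalar_of_re// ltW.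
apply: (AB (_, x)); split=> /=; last exact: nbhs_singleton.
apply: eA; rewrite -ball_normE/= sub0r normrN scalar_norm_of invf_div.
have re0 : 0 < scalar_re e.
  by rewrite -(@scalar_of_lt _ k) scalar_of0 scalar_of_re// ltW.
rewrite ger0_norm ?divr_ge0 ?ltW// -[ltRHS]scalar_of_re ?ltW// scalar_of_lt.
by rewrite ltr_pdivrMr//; lra.
Qed.

Lemma convex_nbhs0 (U : set E) : nbhs 0 U -> exists V : set E,
  [/\ nbhs 0 V, V `<=` U, forall x, V x -> V (- x) &
    forall (t : R) x y, 0 <= t -> t <= 1 -> V x -> V y ->
      V (t%:K *: x + (1 - t)%:K *: y)].
Proof.
have [B Bconv [Bo Bb]] := @locally_convex K E.
move=> /(Bb 0) [W [BW W0] WU].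
have nW : nbhs 0 W by apply: open_nbhs_nbhs; split => //; exact: Bo.
have Wconv (t : R) x y : 0 <= t -> t <= 1 -> W x -> W y ->
    W (t%:K *: x + (1 - t)%:K *: y).
  move=> t0 t1 Wx Wy.
  have tK0 : 0 <= (t%:K : K) by rewrite -scalar_of0 scalar_of_le.
  have tK1 : (t%:K : K) <= 1 by rewrite -scalar_of1 scalar_of_le.
  have := Bconv W (mem_set BW) x y (Itv01 tK0 tK1) (mem_set Wx) (mem_set Wy).
  rewrite inE /= /conv/= scalar_ofD scalar_ofN scalar_of1.
  by [].
exists (W `&` [set x | W (- x)]); split.
- apply: filterI => //.
  have := nbhs0N nW; apply: filterS => _ [x Wx <-] /=.
  by rewrite opprK.
- by move=> x [/WU].
- by move=> x [Wx Wnx]; split => //=; rewrite opprK.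
- move=> t x y t0 t1 [Wx Wnx] [Wy Wny]; split => /=; first exact: Wconv.
  by rewrite opprD -!scalerN; exact: Wconv.
Qed.

(** The seminorm is the gauge [x |-> inf {t > 0 | t^-1 x \in V}] of a convex
    symmetric neighbourhood [V] inside [U]. *)
Lemma gauge_seminorm (U : set E) : nbhs 0 U ->
  exists2 p, continuous_seminorm p & [set x | p x < 1] `<=` U.
Proof.
move=> /convex_nbhs0[V [V0 VU VN Vc]].
pose S x := [set t : R | 0 < t /\ V (t^-1%:K *: x)].
have Sn x : S x !=set0.
  by have [t t0 Vt] := absorbing x V0; exists t.
have lbS x : lbound (S x) 0 by move=> t [/ltW].
have Sb x : has_lbound (S x) by exists 0.
have nz (t : R) : 0 < t -> (t%:K : K) != 0.
  by move=> t0; rewrite gt_eqF// -scalar_of0 scalar_of_lt.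
exists (fun x => inf (S x)).
  split.
  - apply: (@inf_sublinear R (realification E) S) => //.
    + move=> x y s t [s0 Vs] [t0 Vt]; exists (s + t) => //.
      split; first exact: addr_gt0.
      have st0 : 0 < s + t by exact: addr_gt0.
      (* [(s + t)^-1 (x + y)] is the convex combination of [s^-1 x] and [t^-1 y]
         with weights [s / (s + t)] and [t / (s + t)] *)
      have := Vc (s / (s + t)) _ _ _ _ Vs Vt.
      rewrite !scalerA -!scalar_ofM.
      have -> : s / (s + t) * s^-1 = (s + t)^-1.
        by field; rewrite !gt_eqF.
      have -> : (1 - s / (s + t)) / t = (s + t)^-1.
        by field; rewrite !gt_eqF.
      rewrite -scalerDr; apply; first by rewrite divr_ge0// ltW.
      by rewrite ler_pdivrMr// mul1r; lra.
    + move=> r x s r0 [s0 Vs]; exists (r * s) => //.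
      split; first exact: mulr_gt0.
      rewrite (_ : (r : R) *: (x : realification E) = r%:K *: (x : E))//.
      rewrite scalerA -scalar_ofM invfM mulrAC mulVf ?gt_eqF// mul1r//.
  - move=> x; congr inf; apply/seteqP; split=> t [t0 /VN];
      by rewrite -scalerN ?opprK.
  - move=> e e0; have := nbhs0Z (nz (e / 2) (divr_gt0 e0 (ltr0Sn _ _))) V0.
    apply: filterS => _ [x Vx <-] /=.
    apply: (@le_lt_trans _ _ (e / 2)); last by lra.
    apply: ge_inf => //; split; first by lra.
    by rewrite scalerA -scalar_ofM mulVf ?scalar_of1 ?scale1r// gt_eqF//; lra.
move=> x /=; move=> /(inf_lt (Sn x)) [t [t0 Vt] t1]; apply: VU.
have := Vc t _ 0 (ltW t0) (ltW t1) Vt (nbhs_singleton V0).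
by rewrite scaler0 addr0 scalerA -scalar_ofM mulfV ?gt_eqF// scalar_of1 scale1r.
Qed.

Lemma linear_continuous0 (e' : {linear E -> K^o}) :
  (forall e : R, 0 < e -> \forall x \near 0, `|e' x| < e%:K) -> continuous e'.
Proof.
move=> h x; apply/scalar_cvgP => e e0.
have c : (x - y) @[y --> x] --> (0 : E).
  rewrite -(subrr x); apply: (@continuous_comp _ _ _ (fun y => (x, y))
    (fun z => z.1 - z.2)); last exact: sub_continuous.
  by apply: cvg_pair => /=; [exact: cvg_cst|exact: cvg_id].
have cx : \forall y \near x, `|e' (x - y)| < e%:K := c _ (h e e0).
by apply: filterS cx => y; rewrite raddfB.
Qed.

End continuous_seminorm.

(** Over the complex numbers the functional with real part [phi] is
    [x |-> phi x - i phi (i x)]. *)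
Lemma complexify (R : realType) (k : scalar_kind)
    (E : tvsType (scalar_field R k)) (phi : E -> R) :
  (forall x y, phi (x + y) = phi x + phi y) ->
  (forall (r : R) x, phi (r%:K *: x) = r * phi x) ->
  (forall e : R, 0 < e -> \forall x \near 0, `|phi x| < e) ->
  real_functional phi.
Proof.
case: k E phi => [|] E phi phiD phiZ phi0.
  have l : linear (phi : E -> R^o) by move=> a x y; rewrite phiD phiZ.
  pose e' : {linear E -> R^o} := HB.pack (phi : E -> R^o)
    (GRing.isLinear.Build R E R^o _ _ l).
  by exists e' => //; exact: linear_continuous0.
pose C := scalar_field R ComplexScalars.
pose i : C := 'i%C.
pose f x : C^o :=
  (phi x +i* - phi (i *: x))%C.
have l : linear f.
  move=> [a b] x y; rewrite /f scalerDr !phiD.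
  have cE (z : E) :
      ((a +i* b)%C : C) *: z = (a%:K : C) *: z + (b%:K : C) *: (i *: z).
    rewrite scalerA -scalerDl; congr (_ *: _).
    by apply/eqP; rewrite eq_complex /=; apply/andP; split; apply/eqP; lra.
  rewrite scalerA mulrC -scalerA !cE !phiD !phiZ !scalerA.
  have -> : i * i = -1.
    by rewrite -expr2 sqr_i.
  rewrite scaleN1r.
  have -> : phi (- x) = - phi x.
    by have := phiZ (-1) x; rewrite scalar_ofN scalar_of1 scaleN1r mulN1r.
  apply/eqP; rewrite eq_complex /=; apply/andP; split; apply/eqP; lra.
pose e' : {linear E -> C^o} :=
  HB.pack f (GRing.isLinear.Build _ E _ _ _ l).
exists e' => //; apply: linear_continuous0 => e e0.
have e20 : 0 < e / 2 by rewrite divr_gt0.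
have ci : (i *: x) @[x --> 0] --> (0 : E).
  rewrite -[X in _ --> X](scaler0 _ i).
  apply: (@continuous_comp _ _ _ (fun x : E => (i, x) : (C^o * E)%type)
    (fun z : (C^o * E)%type => z.1 *: z.2)); last exact: scale_continuous.
  by apply: (@cvg_pair _ _ _ _ (nbhs (i : C^o)));
    [exact: cvg_cst|exact: cvg_id].
have := ci _ (phi0 _ e20); have := phi0 _ e20.
apply: filterS2 => x /= h1 h2.
have fle : `|f x| <= ((`|phi x| + `|phi (i *: x)|)%:K : C).
  rewrite /f normc_def /= lecR -[leRHS]ger0_norm ?addr_ge0// -sqrtr_sqr.
  rewrite ler_wsqrtr// sqrrN sqrrD !real_normK ?num_real//.
  by rewrite addrAC lerDl mulrn_wge0// mulr_ge0.
apply: (le_lt_trans fle); rewrite scalar_of_lt; lra.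
Qed.

Section hahn_banach_tvs.
Context (R : realType) (k : scalar_kind).
Notation K := (scalar_field R k).
Context (E : tvsType K).
Implicit Types (x y : E) (p phi : E -> R).

Lemma dominated_real_functional p phi : continuous_seminorm p ->
  (forall x y, phi (x + y) = phi x + phi y) ->
  (forall (r : R) x, phi (r%:K *: x) = r * phi x) ->
  (forall x, `|phi x| <= p x) -> real_functional phi.
Proof.
move=> [sp pN p0] phiD phiZ phip; apply: complexify => // e /p0.
by apply: filterS => x; exact: le_lt_trans.
Qed.

Lemma hahn_banach_tvs p x : continuous_seminorm p ->
  exists phi, [/\ real_functional phi, forall y, `|phi y| <= p y & phi x = p x].
Proof.
move=> cp; have [sp pN p0] := cp.
have [phi [phiD phiZ phip phix]] := hahn_banach (x : realification E) sp.
have phip' y : `|phi y| <= p y.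
  rewrite ler_norml phip andbT; have := phip (- y); rewrite pN.
  have := phiZ (-1) y; rewrite scaleN1r mulN1r => ->; lra.
by exists phi; split => //; exact: (dominated_real_functional cp).
Qed.

Lemma real_functional_separates x y : hausdorff_space E ->
  (forall phi, real_functional phi -> phi x = phi y) -> x = y.
Proof.
move=> hE h; apply: contrapT => xy.
have xy0 : x - y <> 0 by move/eqP; rewrite subr_eq0 => /eqP.
have [U U0 nU] : exists2 U, nbhs (0 : E) U & ~ U (x - y).
  apply: contrapT => nex; apply: xy0; apply: hE => A B Ax B0.
  exists (x - y); split; first exact: nbhs_singleton.
  by apply: contrapT => nB; apply: nex; exists B.
have [p cp pU] := gauge_seminorm U0.
have [phi [rphi _ phixy]] := hahn_banach_tvs (x - y) cp.
apply: nU; apply: pU => /=.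
by rewrite -phixy real_functionalB// h// subrr.
Qed.

End hahn_banach_tvs.

(** * Weakly bounded sets are bounded *)

Section mackey.
Context (R : realType) (k : scalar_kind).
Notation K := (scalar_field R k).
Context (E : tvsType K).
Implicit Types (x y : E) (p phi : E -> R).

Definition weakly_bounded (D : set E) := forall phi, real_functional phi ->
  exists M, forall x, D x -> `|phi x| <= M.

(** Partial sums of [\sum_m +- 3^-(m+1) psi m]. The sign of the new term agrees
    with the value of the previous partial sum at [x m], so that the two add up
    in absolute value there. *)
Fixpoint hump (x : nat -> E) (psi : nat -> E -> R) (n : nat) (y : E) : R :=
  if n is m.+1 then
    hump x psi m y +
    (if 0 <= hump x psi m (x m) then 1 else - 1) * (3^-1 ^+ m.+1 * psi m y)
  else 0.

(** The series converges to a functional dominated by [p]. At [x n] the partial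
    sum up to [psi n] is at least [3^-(n+1) p (x n)] in absolute value, and the
    terms that follow contribute at most half of that. *)
Lemma hump_functional (p : E -> R) (x : nat -> E) (psi : nat -> E -> R) :
  continuous_seminorm p -> (forall n, real_functional (psi n)) ->
  (forall n y, `|psi n y| <= p y) -> (forall n, psi n (x n) = p (x n)) ->
  exists2 phi, real_functional phi &
    forall n, 2^-1 * 3^-1 ^+ n.+1 * p (x n) <= `|phi (x n)|.
Proof.
move=> cp rpsi psip psix; pose u n y := hump x psi n y.
have u_dist y n m : `|u (n + m)%N y - u n y| <=
    2^-1 * (3^-1 ^+ n - 3^-1 ^+ (n + m)) * p y.
  elim: m => [|m IH]; first by rewrite addn0 !subrr normr0 mulr0 mul0r.
  rewrite addnS /u /= -/(u _ y) addrAC.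
  apply: le_trans (ler_normD _ _) _.
  apply: (@le_trans _ _ (2^-1 * (3^-1 ^+ n - 3^-1 ^+ (n + m)) * p y +
      3^-1 ^+ (n + m).+1 * p y)); last first.
    by rewrite exprS; lra.
  apply: lerD => //; rewrite !normrM.
  rewrite (_ : `|if _ then _ else _| = 1); last first.
    by case: ifP => _; rewrite ?normrN normr1.
  by rewrite mul1r ger0_norm ?exprn_ge0// ler_wpM2l// exprn_ge0.
have p0 y : 0 <= p y by exact: seminorm_ge0.
have u_dist' y n m : (n <= m)%N -> `|u m y - u n y| <= 2^-1 * 3^-1 ^+ n * p y.
  move=> nm; rewrite -(subnKC nm); apply: le_trans (u_dist _ _ _) _.
  by rewrite ler_wpM2r// ler_wpM2l// gerBl exprn_ge0.
have u_cvg y : cvgn (u ^~ y).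
  apply/cauchy_cvgP/cauchy_exP => e e0.
  have [N _ hN] : \forall n \near \oo, 3^-1 ^+ n * p y < e.
    have : 3^-1 ^+ n * p y @[n --> \oo] --> (0 : R).
      rewrite -[X in _ --> X](mul0r (p y)); apply: cvgMl.
      by apply: cvg_expr; rewrite ger0_norm; lra.
    by move/cvgr_lt; apply.
  exists (u N y); exists N => // m /= Nm; rewrite -ball_normE/= distrC.
  apply: le_lt_trans (u_dist' _ _ _ Nm) _.
  apply: le_lt_trans (hN N (leqnn _)).
  by rewrite -mulrA ler_piMl//; [rewrite mulr_ge0// exprn_ge0|lra].
pose phi y := limn (u ^~ y).
have phi_dist y n : `|phi y - u n y| <= 2^-1 * 3^-1 ^+ n * p y.
  rewrite ler_distl; apply/andP; split.
    apply: limr_ge => //; exists n => // m /= /(u_dist' y).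
    by rewrite ler_distl => /andP[].
  apply: limr_le => //; exists n => // m /= /(u_dist' y).
  by rewrite ler_distl => /andP[].
have uD n y z : u n (y + z) = u n y + u n z.
  elim: n => [|n IH]; first by rewrite /u /= addr0.
  rewrite /u /= -!/(u _ _) IH real_functionalD//; ring.
have uZ n (r : R) y : u n (r%:K *: y) = r * u n y.
  elim: n => [|n IH]; first by rewrite /u /= mulr0.
  rewrite /u /= -!/(u _ _) IH real_functionalZ//; ring.
exists phi.
  apply: (dominated_real_functional cp).
  - move=> y z; rewrite /phi -limD//; congr (lim (_ @ \oo)).
    by apply/funext => n; exact: uD.
  - move=> r y; apply: cvg_lim => //.
    rewrite (_ : u ^~ _ = fun n => r * u n y); first exact: cvgMr.
    by apply/funext => n; exact: uZ.
  - move=> y; have := phi_dist y 0%N; rewrite /u/= subr0 expr0.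
    by have := p0 y; lra.
move=> n; have h1 : 3^-1 ^+ n.+1 * p (x n) <= `|u n.+1 (x n)|.
  have q0 : 0 <= 3^-1 ^+ n.+1 * p (x n) by rewrite mulr_ge0// exprn_ge0.
  rewrite /u /= -/(u _ _) psix; case: ifP => [|/negbT].
    by move=> u0; rewrite mul1r ger0_norm ?addr_ge0// lerDr.
  rewrite -ltNge => u0; rewrite mulN1r ler0_norm; last by lra.
  by lra.
have := ler_normB (phi (x n)) (phi (x n) - u n.+1 (x n)).
have := phi_dist (x n) n.+1; rewrite subKr.
lra.
Qed.

(** If [p] is unbounded on [D], choose [x n] in [D] with [p (x n)] growing faster
    than [3^n n], and [psi n] of size [p] norming [x n]: the gliding hump is then
    a single functional that is unbounded on [D]. *)
Lemma weakly_bounded_seminorm (D : set E) p :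
  weakly_bounded D -> continuous_seminorm p ->
  exists M, forall x, D x -> p x <= M.
Proof.
move=> wD cp; apply: contrapT => nM.
(* the growth is chosen to cancel the factor of [hump_functional] *)
have xE (n : nat) : exists x, D x /\ 2 * 3 ^+ n.+1 * n%:R < p x.
  apply: contrapT => nx; apply: nM; exists (2 * 3 ^+ n.+1 * n%:R) => x Dx.
  by rewrite leNgt; apply/negP => px; apply: nx; exists x.
have [x xP] := choice xE.
have [psi psiP] := choice (fun n => hahn_banach_tvs (x n) cp).
have [|||phi rphi phix] := @hump_functional p x psi cp.
- by move=> n; have [] := psiP n.
- by move=> n; have [] := psiP n.
- by move=> n; have [] := psiP n.
have [M Mphi] := wD _ rphi.
have [n Mn] : exists n : nat, M < n%:R.
  exists (Num.bound `|M|).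
  exact: le_lt_trans (ler_norm _) (archi_boundP (normr_ge0 _)).
have [Dx px] := xP n.
have : n%:R < `|phi (x n)|.
  apply: lt_le_trans (phix n); rewrite -[ltRHS]mulrA ltr_pdivlMl//.
  by rewrite exprVn ltr_pdivlMl ?exprn_gt0// mulrCA mulrA.
by have := Mphi _ Dx; lra.
Qed.

Lemma weakly_bounded_bounded (D : set E) : weakly_bounded D -> tvs_bounded D.
Proof.
move=> wD U /gauge_seminorm[p cp pU].
have [M DM] := weakly_bounded_seminorm wD cp.
have M0 : 0 < `|M| + 1 by rewrite ltr_wpDl.
have nz : ((`|M| + 1)%:K : K) != 0 by rewrite gt_eqF// -scalar_of0 scalar_of_lt.
exists (`|M| + 1) => // x Dx; exists ((`|M| + 1)%:K^-1 *: x) => /=.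
  apply: pU; rewrite /= -scalar_ofV.
  have [sp _ _] := cp.
  have := @sublinearZ R (realification E) p (`|M| + 1)^-1 x sp.
  rewrite invr_ge0 => /(_ (ltW M0)) => pE.
  rewrite (_ : p _ = (`|M| + 1)^-1 * p x); last exact: pE.
  rewrite ltr_pdivrMl// mulr1; have := DM x Dx; have := ler_norm M; lra.
by rewrite scalerA mulfV// scale1r.
Qed.

End mackey.

(** * Sequences that are Cauchy at a weakly uniform rate *)

Section weak_fast_cauchy.
Context (R : realType) (k : scalar_kind).
Notation K := (scalar_field R k).

(** Weak boundedness passes to the balanced hull: over the complex numbers,
    [phi (u x)] is a combination of [phi x] and [phi (i x)] with coefficients at
    most 1 in absolute value. *)
Lemma real_functional_rotation_bound (E : tvsType K) (phi : E -> R) :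
  real_functional phi -> exists2 phi', real_functional phi' &
  forall (u : K) x, `|u| <= 1 -> `|phi (u *: x)| <= `|phi x| + `|phi' x|.
Proof.
case: k E phi => [|] E phi rphi.
  exists phi => // u x u1; rewrite (real_functionalZ u x rphi) normrM.
  by rewrite (@le_trans _ _ `|phi x|) ?lerDl// ler_piMl.
pose C := scalar_field R ComplexScalars.
pose i : C := 'i%C.
exists (fun x => phi (i *: x)); first exact: real_functional_rotate.
move=> [a b] x u1.
have -> : ((a +i* b)%C : C) *: x = (a%:K : C) *: x + (b%:K : C) *: (i *: x).
  rewrite scalerA -scalerDl; congr (_ *: _).
  by apply/eqP; rewrite eq_complex /=; apply/andP; split; apply/eqP; lra.
rewrite real_functionalD// !real_functionalZ//.
apply: le_trans (ler_normD _ _) _; rewrite !normrM.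
have a1 : `|a| <= 1.
  by rewrite -lecR; apply: le_trans u1; exact: (normc_ge_Re (a +i* b)%C).
have b1 : `|b| <= 1.
  rewrite -lecR; apply: le_trans u1.
  by rewrite normc_def /= lecR -sqrtr_sqr ler_wsqrtr// lerDr sqr_ge0.
by apply: lerD; rewrite ler_piMl.
Qed.

Context (E : tvsType K).
Implicit Types (x y : E) (phi : E -> R) (s : nat -> E).

Definition weakly_fast_cauchy s := forall phi, real_functional phi ->
  exists M, forall n m,
    `|phi (s n - s m)| <= M * (n.+1%:R^-1 + m.+1%:R^-1).

(** This is the bipolar of the quotients [(s n - s m) / (1/(n+1) + 1/(m+1))].
    Bounding a functional on all their rotations by scalars [u] makes the set
    absolutely convex over the complex numbers too. *)
Definition cauchy_disk s : set E := [set x | forall phi M,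
  real_functional phi ->
  (forall (u : K) n m, `|u| <= 1 ->
    `|phi (u *: (s n - s m))| <= M * (n.+1%:R^-1 + m.+1%:R^-1)) ->
  `|phi x| <= M].

Let eps (n m : nat) : R := n.+1%:R^-1 + m.+1%:R^-1.
Let eps_gt0 n m : 0 < eps n m.
Proof. by rewrite addr_gt0// invr_gt0. Qed.

Lemma cauchy_disk_absolutely_convex s : absolutely_convex (cauchy_disk s).
Proof.
move=> a b x y ab Dx Dy phi M rphi phiM.
have M0 : 0 <= M.
  have := phiM 0 0%N 0%N; rewrite normr0 ler01 => /(_ isT).
  rewrite scale0r real_functional0// normr0 => h; move: h.
  by rewrite pmulr_lge0//; exact: eps_gt0.
(* [c = |c| (c / |c|)], and rotating [phi] preserves the bound [M] *)
have scaled (c : K) z : cauchy_disk s z ->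
    `|phi (c *: z)| <= scalar_re `|c| * M.
  move=> Dz; have [->|c0] := eqVneq c 0.
    rewrite scale0r real_functional0// !normr0.
    by rewrite (_ : scalar_re 0 = 0) ?mul0r// -(scalar_of0 R) scalar_ofK.
  have nc0 : `|c| != 0 by rewrite normr_eq0.
  have -> : c *: z = (scalar_re `|c|)%:K *: ((c / `|c|) *: z).
    by rewrite scalar_of_re// scalerA mulrCA divff// mulr1.
  have re0 : 0 <= scalar_re `|c|.
    by rewrite -(@scalar_of_le _ k) scalar_of0 scalar_of_re.
  rewrite real_functionalZ// normrM ger0_norm// ler_wpM2l//.
  apply: (Dz (fun z => phi ((c / `|c|) *: z))).
    exact: real_functional_rotate.
  move=> u n m u1; rewrite scalerA; apply: phiM.
  by rewrite !normrM normfV normr_id divff// mul1r.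
rewrite real_functionalD//; apply: le_trans (ler_normD _ _) _.
apply: le_trans (lerD (scaled _ _ Dx) (scaled _ _ Dy)) _.
rewrite -mulrDl ler_piMl// -(@scalar_of_le _ k) scalar_of1 scalar_ofD.
by rewrite !scalar_of_re.
Qed.

(** Being a bipolar, the set is an intersection of closed slabs
    [{x | |phi x| <= M}]. *)
Lemma cauchy_disk_closed s : closed (cauchy_disk s).
Proof.
pose F (phiM : (E -> R) * R) := [set x | `|phiM.1 x| <= phiM.2].
rewrite (_ : cauchy_disk s = \bigcap_(phiM in [set phiM : (E -> R) * R |
    real_functional phiM.1 /\ forall (u : K) n m, `|u| <= 1 ->
    `|phiM.1 (u *: (s n - s m))| <= phiM.2 * eps n m]) F phiM).
  apply: closed_bigI => -[phi M] /= [rphi _].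
  apply: (@closed_comp _ _ (fun x => `|phi x|) [set r | r <= M]); last first.
    exact: closed_le.
  move=> x _; apply: continuous_comp; last exact: norm_continuous.
  exact: real_functional_continuous.
apply/seteqP; split=> [x Dx [phi M] /= [rphi h]|x h phi M rphi hM].
  exact: Dx.
exact: (h (phi, M)).
Qed.

Lemma cauchy_disk_weakly_bounded s : weakly_fast_cauchy s ->
  weakly_bounded (cauchy_disk s).
Proof.
move=> sM phi rphi.
have [phi' rphi' rot] := real_functional_rotation_bound rphi.
have [M phiM] := sM _ rphi; have [M' phiM'] := sM _ rphi'.
exists (M + M') => x; apply => // u n m u1.
by apply: le_trans (rot _ _ u1) _; rewrite mulrDl lerD.
Qed.

Lemma cauchy_disk_is_disk s : weakly_fast_cauchy s ->
  is_disk (cauchy_disk s).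
Proof.
move=> sM; split.
- exists 0 => phi M rphi /(_ 0 0%N 0%N); rewrite normr0 ler01 => /(_ isT).
  rewrite scale0r real_functional0// normr0 => h; move: h.
  by rewrite pmulr_lge0//; exact: eps_gt0.
- exact: cauchy_disk_absolutely_convex.
- exact/weakly_bounded_bounded/cauchy_disk_weakly_bounded.
Qed.

Lemma cauchy_disk_difference s n m :
  cauchy_disk s ((eps n m)^-1%:K *: (s n - s m)).
Proof.
move=> phi M rphi phiM; rewrite real_functionalZ// normrM gtr0_norm; last first.
  by rewrite invr_gt0.
rewrite ler_pdivrMl// mulrC; have := phiM 1 n m.
by rewrite normr1 scale1r => /(_ (lexx _)).
Qed.

(** A functional bounded on [D] is continuous for the norm of the span of [D]. *)
Lemma disk_gauge_functional (D : set E) phi (M : R) x : absolutely_convex D ->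
  real_functional phi -> 0 <= M -> (forall y, D y -> `|phi y| <= M) ->
  disk_span D x -> `|phi x| <= M * disk_gauge D x.
Proof.
move=> cD rphi M0 DM [n _ [y Dy yx]].
have Sn : [set t : R | 0 < t /\ [set t%:K *: z | z in D] x] !=set0.
  exists n.+1%:R; split => //; exists ((n%:R / n.+1%:R)%:K *: y).
    rewrite -[_ *: y]addr0 -[X in _ + X](scale0r y).
    apply: cD => //; rewrite normr0 addr0 scalar_norm_of -scalar_of1.
    rewrite scalar_of_le ger0_norm ?divr_ge0// ler_pdivrMr// mul1r ler_nat//.
  rewrite scalerA -scalar_ofM mulrCA divff ?mulr1 ?pnatr_eq0//.
  by rewrite scalar_of_nat.
rewrite le_eqVlt in M0; case/predU1P: M0 => [M0|M0].
  rewrite -M0 mul0r -yx -(scalar_of_nat R) real_functionalZ// normrM.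
  by rewrite (le_trans (ler_wpM2l _ (DM _ Dy)))// -M0 mulr0.
rewrite -ler_pdivrMl//; apply: lb_le_inf => // t [t0 [z Dz <-]].
rewrite ler_pdivrMl// real_functionalZ// normrM gtr0_norm// mulrC.
by rewrite ler_wpM2r ?DM// ltW.
Qed.

Lemma disk_gauge_le (D : set E) (t : R) x :
  0 < t -> D (t^-1%:K *: x) -> disk_gauge D x <= t.
Proof.
move=> t0 Dx; apply: ge_inf; first by exists 0 => r [/ltW].
split => //; exists (t^-1%:K *: x) => //.
by rewrite scalerA -scalar_ofM divff ?scalar_of1 ?scale1r// gt_eqF.
Qed.

Lemma disk_span_scaled (D : set E) (t : R) x : absolutely_convex D ->
  0 < t -> D (t^-1%:K *: x) -> disk_span D x.
Proof.
move=> cD t0 Dx; set n := (Num.bound t).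
have tn : t < n%:R by rewrite archi_boundP// ltW.
have n0 : (n%:R : R) != 0 by rewrite gt_eqF// (lt_trans t0).
exists n => //; exists (n%:R^-1%:K *: x); last first.
  by rewrite -(scalar_of_nat R) scalerA -scalar_ofM divff// scalar_of1 scale1r.
rewrite (_ : _ *: x = (t / n%:R)%:K *: (t^-1%:K *: x) + 0 *: (t^-1%:K *: x)).
  apply: cD => //; rewrite normr0 addr0 scalar_norm_of -scalar_of1.
  rewrite scalar_of_le ger0_norm ?divr_ge0 ?(ltW t0)//.
  by rewrite ler_pdivrMr ?mul1r ?(ltW tn)// (lt_trans t0).
by rewrite scale0r addr0 scalerA -scalar_ofM mulrAC divff ?mul1r// gt_eqF.
Qed.

(** The differences [s n - s 0] lie in the span of the disk, with
    [|s n - s m| <= 1/(n+1) + 1/(m+1)] for its norm; completeness of that normed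
    space provides the limit. *)
Lemma weakly_fast_cauchy_cvg s :
  locally_complete E -> weakly_fast_cauchy s ->
  exists v, forall phi, real_functional phi ->
    phi (s n) @[n --> \oo] --> phi v.
Proof.
move=> lcE sM; set D := cauchy_disk s.
have dD := cauchy_disk_is_disk sM; have [_ cD bD] := dD.
have [X [j [jinj jD jnorm]]] := lcE D dD (@cauchy_disk_closed s).
have /choice[x xE] n : exists y : X, j y = s n - s 0%N.
  have : range j (s n - s 0%N).
    rewrite jD.
    exact: disk_span_scaled cD (eps_gt0 n 0%N) (@cauchy_disk_difference s n 0).
  by case=> y _ <-; exists y.
have x_dist n m : `|x n - x m| <= (eps n m)%:K.
  rewrite jnorm scalar_of_le raddfB/= !xE opprB addrA subrK.
  by apply: disk_gauge_le => //; exact: cauchy_disk_difference.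
have inv_small (e : R) : 0 < e -> \forall n \near \oo, n.+1%:R^-1 < e.
  by move=> e0; exact: (near_infty_natSinv_lt (PosNum e0)).
have cx : cvgn x.
  apply/cauchy_cvgP/cauchy_exP => e e0.
  have re0 : 0 < scalar_re e.
    by rewrite -(@scalar_of_lt _ k) scalar_of0 scalar_of_re// ltW.
  have [N _ hN] := inv_small (scalar_re e / 2) (divr_gt0 re0 (ltr0Sn _ _)).
  exists (x N); exists N => // m /= Nm; rewrite -ball_normE/=.
  apply: le_lt_trans (x_dist _ _) _.
  rewrite -[ltRHS]scalar_of_re ?ltW// scalar_of_lt /eps.
  by rewrite [ltRHS]splitr ltrD//; [exact: (hN N (leqnn N))|exact: hN].
exists (s 0%N + j (limn x)) => phi rphi.
have [M DM] := cauchy_disk_weakly_bounded sM rphi.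
have M0 : 0 < `|M| + 1 by rewrite ltr_wpDl.
apply/cvgrPdist_lt => e e0.
have eM : 0 < e / (`|M| + 1) by rewrite divr_gt0.
have eMK : 0 < ((e / (`|M| + 1))%:K : K) by rewrite -scalar_of0 scalar_of_lt.
have : \forall n \near \oo, `|limn x - x n| < (e / (`|M| + 1))%:K.
  by have /cvgrPdist_lt := cx; apply.
apply: filterS => n.
rewrite jnorm scalar_of_lt ltr_pdivlMr// mulrC; apply: le_lt_trans.
have -> : phi (s 0%N + j (limn x)) - phi (s n) = phi (j (limn x - x n)).
  rewrite -real_functionalB// raddfB/= xE; congr phi.
  by rewrite opprB addrA; congr (_ - _); rewrite addrC.
apply: disk_gauge_functional => //.
- by move=> y /DM h; apply: le_trans h _; have := ler_norm M; lra.
- by rewrite -jD; exists (limn x - x n).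
Qed.

End weak_fast_cauchy.

(** * Integrals of Lipschitz functions *)

Lemma bounded_integrable (d : measure_display) (T : measurableType d)
    (R : realType) (mu : {measure set T -> \bar R}) (A : set T) (f : T -> R)
    (M : R) :
  measurable A -> (mu A < +oo)%E -> measurable_fun A f ->
  (forall x, A x -> `|f x| <= M) -> mu.-integrable A (EFin \o f).
Proof.
move=> mA muA mf fM; apply: measurable_bounded_integrable => //.
exists M; split; first exact: num_real.
by move=> M' /ltW MM' x Ax; exact: le_trans (fM x Ax) MM'.
Qed.

Lemma Rintegral_dist (d : measure_display) (T : measurableType d)
    (R : realType) (mu : {measure set T -> \bar R}) (A : set T) (f g : T -> R)
    (M m : R) : measurable A -> mu A = m%:E ->
  mu.-integrable A (EFin \o f) -> mu.-integrable A (EFin \o g) ->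
  (forall x, A x -> `|f x - g x| <= M) ->
  `|\int[mu]_(x in A) f x - \int[mu]_(x in A) g x| <= M * m.
Proof.
move=> mA Am fi gi fgM.
have fgi : mu.-integrable A (EFin \o (fun x => f x - g x)).
  by have := integrableB mA fi gi; apply: eq_integrable.
rewrite -RintegralB//; apply: le_trans (le_normr_Rintegral mA fgi) _.
have -> : m = fine (mu A) by rewrite Am.
rewrite -Rintegral_cst//; apply: le_Rintegral => //.
  by have := integrable_norm fgi; apply: eq_integrable.
by apply: (@bounded_integrable _ _ _ _ _ _ `|M|) => //; rewrite Am ltry.
Qed.

Lemma Rintegral_dist_cst (d : measure_display) (T : measurableType d)
    (R : realType) (mu : {measure set T -> \bar R}) (A : set T) (g : T -> R)
    (c M m : R) : measurable A -> mu A = m%:E ->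
  mu.-integrable A (EFin \o g) -> (forall x, A x -> `|g x - c| <= M) ->
  `|\int[mu]_(x in A) g x - c * m| <= M * m.
Proof.
move=> mA Am gi gM.
have -> : c * m = \int[mu]_(_ in A) c by rewrite Rintegral_cst// Am.
apply: Rintegral_dist => //.
by apply: (@bounded_integrable _ _ _ _ _ _ `|c|) => //; rewrite Am ltry.
Qed.

Section lipschitz_itv.
Context (R : realType).
Implicit Types (a b L : R) (g : R -> R).
Notation mu := (@lebesgue_measure R).

Definition lipschitz_itv L a b g := forall x y,
  x \in `[a, b] -> y \in `[a, b] ->
  `|g x - g y| <= L * `|x - y|.

(** Composing with the projection onto [[a, b]] extends a Lipschitz function from
    the interval to the line, where continuity gives measurability. *)
Definition clamp a b x : R := Num.max a (Num.min b x).

Lemma clamp_in a b x : a <= b -> clamp a b x \in `[a, b].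
Proof.
by move=> ab; rewrite in_itv/= /clamp le_max lexx/= ge_max ab ge_min lexx.
Qed.

Lemma clamp_id a b x : x \in `[a, b] -> clamp a b x = x.
Proof.
by rewrite in_itv/= => /andP[ax xb]; rewrite /clamp min_r// max_r.
Qed.

Lemma clamp_dist a b x y : `|clamp a b x - clamp a b y| <= `|x - y|.
Proof.
rewrite /clamp /Num.max /Num.min ler_distl.
have := ler_norm (x - y); have := ler_norm (y - x); rewrite distrC.
by do !case: ifPn; rewrite -?leNgt; move=> *; apply/andP; split; lra.
Qed.

Lemma lipschitz_continuous L g :
  (forall x y, `|g x - g y| <= L * `|x - y|) -> continuous g.
Proof.
move=> gL x; have L0 : 0 < `|L| + 1 by rewrite ltr_wpDl.
apply/cvgrPdist_lt => e e0; near=> y; apply: le_lt_trans (gL _ _) _.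
apply: (@le_lt_trans _ _ ((`|L| + 1) * `|x - y|)).
  by rewrite ler_wpM2r// (le_trans (ler_norm L))// lerDl.
rewrite -ltr_pdivlMl//; near: y; apply: cvgr_dist_lt => //.
by rewrite mulr_gt0// invr_gt0.
Unshelve. all: by end_near. Qed.

Lemma lipschitz_clamp L a b g x y : a <= b -> 0 <= L -> lipschitz_itv L a b g ->
  `|g (clamp a b x) - g (clamp a b y)| <= L * `|x - y|.
Proof.
move=> ab L0 gL; apply: le_trans (gL _ _ (clamp_in _ ab) (clamp_in _ ab)) _.
by rewrite ler_wpM2l// clamp_dist.
Qed.

Lemma lipschitz_itv_integrable L a b g : a <= b -> 0 <= L ->
  lipschitz_itv L a b g -> mu.-integrable `[a, b] (EFin \o g).
Proof.
move=> ab L0 gL.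
apply: (@eq_integrable _ _ _ mu _ _ (EFin \o (g \o clamp a b))) => //.
  by move=> x; rewrite inE => xab /=; rewrite clamp_id.
apply: continuous_compact_integrable; first exact: segment_compact.
apply: continuous_subspaceT; apply: (@lipschitz_continuous L).
by move=> x y; exact: lipschitz_clamp.
Qed.

(** On each of the [n + 1] cells of width [d] the integrand stays within [L d] of
    its value at the left end, which costs [L d^2] per cell. *)
Lemma riemann_sum_error L a b g (n : nat) : a <= b -> 0 <= L ->
  lipschitz_itv L a b g ->
  `|\int[mu]_(x in `[a, b]) g x -
    \sum_(i < n.+1) (b - a) / n.+1%:R * g (a + i%:R * ((b - a) / n.+1%:R))|
  <= L * (b - a) ^+ 2 * n.+1%:R^-1.
Proof.
move=> ab L0 gL; set d := (b - a) / n.+1%:R.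
have n0 : 0 < n.+1%:R :> R by [].
have d0 : 0 <= d by rewrite divr_ge0 ?subr_ge0.
have ig := lipschitz_itv_integrable ab L0 gL.
pose t (j : nat) := a + j%:R * d.
have tS j : t j.+1 = t j + d by rewrite /t -natr1; ring.
have tn : t n.+1 = b by rewrite /t /d mulrC divfK// addrC subrK.
have t_in j : (j <= n.+1)%N -> t j \in `[a, b].
  move=> jn; rewrite in_itv/= lerDl mulr_ge0//= -tn lerD2l ler_wpM2r//.
  by rewrite ler_nat.
suff H j : (j <= n.+1)%N ->
    `|\int[mu]_(x in `[a, t j]) g x - \sum_(i < j) d * g (t i)|
    <= j%:R * (L * d * d).
  have := H _ (leqnn n.+1); rewrite tn => /le_trans; apply.
  rewrite le_eqVlt; apply/orP; left; apply/eqP.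
  rewrite /d; have := lt0r_neq0 n0; move: (n.+1%:R) => N N0.
  by field.
elim: j => [_|j IH jn].
  by rewrite big_ord0 /t mul0r addr0 set_itv1 Rintegral_set1 subrr normr0 mul0r.
have tj := t_in _ (ltnW jn); have tj1 := t_in _ jn.
have sub1 : `[a, t j.+1] `<=` `[a, b].
  apply: subset_itvl; rewrite bnd_simp.
  by move: tj1; rewrite in_itv/= => /andP[].
have sub2 : `]t j, t j.+1] `<=` `[a, t j.+1].
  apply: subset_itvr; rewrite bnd_simp.
  by move: tj; rewrite in_itv/= => /andP[].
have ig1 : mu.-integrable `[a, t j.+1] (EFin \o g) by apply: integrableS ig.
have ig2 : mu.-integrable `]t j, t j.+1] (EFin \o g) by apply: integrableS ig1.
have split_int := Rintegral_itvB ig1.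
have /(_ (t j)) E := split_int.
have muE : mu `]t j, t j.+1] = d%:E.
  rewrite lebesgue_measure_itv/= lte_fin tS; case: ltP => dd.
    by rewrite -EFinB; congr EFin; ring.
  by congr EFin; lra.
have key : `|\int[mu]_(x in `]t j, t j.+1]) g x - g (t j) * d| <= L * d * d.
  apply: Rintegral_dist_cst => // x xj; have /sub1 xab := sub2 _ xj.
  apply: le_trans (gL _ _ xab tj) _; rewrite ler_wpM2l//.
  by move: xj; rewrite /= in_itv/= tS => /andP[? ?]; rewrite ger0_norm; lra.
rewrite big_ord_recr/=.
have -> : \int[mu]_(x in `[a, t j.+1]) g x = \int[mu]_(x in `[a, t j]) g x +
    \int[mu]_(x in `]t j, t j.+1]) g x.
  rewrite -E ?bnd_simp; first by rewrite addrC subrK.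
    by move: tj; rewrite in_itv/= => /andP[].
  by rewrite tS; lra.
have -> (A B C D : R) : A + B - (C + D) = (A - C) + (B - D) by ring.
apply: le_trans (ler_normD _ _) _.
rewrite -natr1 mulrDl mul1r [d * g _]mulrC; apply: lerD => //.
exact/IH/ltnW.
Qed.

End lipschitz_itv.

(** * Lipschitz functions on a rectangle *)

Section rectangle.
Context (R : realType).
Notation mu := (@lebesgue_measure R).

(** McShane's formula [G (x, y) = inf_q (G (q, y) + L |x - q|)], with [q] ranging
    over the rationals, exhibits [G] as a countable infimum of measurable
    functions. *)
Lemma lipschitz_measurable_section (L : R)
    (G : measurableTypeR R * measurableTypeR R -> R) : 0 < L ->
  (forall x x' y, `|G (x, y) - G (x', y)| <= L * `|x - x'|) ->
  (forall x, measurable_fun setT (fun y : measurableTypeR R => G (x, y))) ->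
  measurable_fun setT G.
Proof.
move=> L0 GL Gm; apply: (measurability _ (RGenInftyO.measurableE R)).
move=> _ [_ [r ->] <-]; rewrite setTI.
pose H (q : rat) (p : measurableTypeR R * measurableTypeR R) : R :=
    G (ratr q, p.2) + L * `|p.1 - ratr q|.
have -> : G @^-1` `]-oo, r[ = \bigcup_q (H q @^-1` `]-oo, r[).
  apply/seteqP; split=> -[x y] /=; rewrite in_itv/=.
    move=> Gr; pose e := (r - G (x, y)) / (2 * L).
    have e0 : 0 < e by rewrite divr_gt0 ?mulr_gt0// subr_gt0.
    have [q xq] : exists q, ratr q \in `](x - e), (x + e)[.
      by apply: rat_in_itvoo; lra.
    exists q => //=; rewrite in_itv/= /H/=.
    have xqe : `|x - ratr q| < e.
      move: xq; rewrite in_itv/= ltr_distl => /andP[? ?].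
      by apply/andP; split; lra.
    have eE : L * e = (r - G (x, y)) / 2 by rewrite /e; field; rewrite gt_eqF.
    have := ler_norm (G (ratr q, y) - G (x, y)).
    have := GL (ratr q) x y; rewrite [`|ratr q - x|]distrC.
    have : L * `|x - ratr q| < L * e by rewrite ltr_pM2l.
    by rewrite eE; lra.
  move=> [q _]; rewrite /= in_itv/= /H/=.
  have := ler_norm (G (x, y) - G (ratr q, y)); have := GL x (ratr q) y; lra.
apply: bigcupT_measurable_rat => q.
have mH : measurable_fun setT (H q).
  apply: measurable_funD.
    exact: (measurableT_comp (Gm (ratr q)) measurable_snd).
  apply: measurable_funM; first exact: measurable_cst.
  apply: measurableT_comp; first exact: normr_measurable.
  by apply: measurable_funB; [exact: measurable_fst|exact: measurable_cst].
by rewrite -[X in measurable X]setTI; apply: mH.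
Qed.

Variables (a b c d L : R) (g : R * R -> R).
Hypotheses (ab : a <= b) (cd : c <= d) (L0 : 0 < L).
Let Q := `[a, b] `*` `[c, d].
Hypothesis g1 : forall y, y \in `[c, d] ->
  lipschitz_itv L a b (fun x => g (x, y)).
Hypothesis g2 : forall x, x \in `[a, b] ->
  lipschitz_itv L c d (fun y => g (x, y)).

Let G (p : measurableTypeR R * measurableTypeR R) : R :=
  g (clamp a b p.1, clamp c d p.2).

Let measurable_G : measurable_fun setT G.
Proof.
apply: (lipschitz_measurable_section L0).
  move=> x x' y; rewrite /G/=.
  exact: (lipschitz_clamp x x' ab (ltW L0) (g1 (clamp_in y cd))).
move=> x; apply: continuous_measurable_fun.
apply: (@lipschitz_continuous _ L) => y y'.
exact: (lipschitz_clamp y y' cd (ltW L0) (g2 (clamp_in x ab))).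
Qed.

Let GE p : Q p -> G p = g p.
Proof. by case: p => x y [/= xab ycd]; rewrite /G/= !clamp_id. Qed.

Let mQ : measurable Q. Proof. exact: measurableX. Qed.

Lemma lipschitz_rectangle_integrable :
  (mu \x mu)%E.-integrable Q (EFin \o g).
Proof.
apply: (@eq_integrable _ _ _ (mu \x mu)%E _ _ (EFin \o G)) => //.
  by move=> p; rewrite inE => /GE /= ->.
apply: (@bounded_integrable _ _ _ _ _ _
    (`|g (a, c)| + L * (b - a) + L * (d - c))) => //.
- apply: (@le_lt_trans _ _ (mu `[a, b] * mu `[c, d])%E).
    by rewrite -product_measure1E.
  by rewrite !lebesgue_measure_itv/= !lte_fin; do 2 case: ifP => _;
    rewrite ?mul0e ?mule0 -?EFinB -?EFinM ?ltry.
- exact: measurable_funS measurable_G.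
- move=> [x y] Qxy; rewrite GE//; case: Qxy => /= xab ycd.
  have aab : a \in `[a, b] by rewrite in_itv/= lexx.
  have ccd : c \in `[c, d] by rewrite in_itv/= lexx.
  have := g1 ycd xab aab; have := g2 aab ycd ccd.
  move: xab ycd; rewrite !in_itv/= => /andP[ax xb] /andP[cy yd].
  rewrite [`|x - a|]ger0_norm ?subr_ge0// [`|y - c|]ger0_norm ?subr_ge0//.
  have : L * (x - a) <= L * (b - a) by rewrite ler_wpM2l ?(ltW L0)// lerD2r.
  have : L * (y - c) <= L * (d - c) by rewrite ler_wpM2l ?(ltW L0)// lerD2r.
  have := ler_normD (g (x, y) - g (a, y)) (g (a, y) - g (a, c) + g (a, c)).
  have := ler_normD (g (a, y) - g (a, c)) (g (a, c)).
  rewrite !subrK; lra.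
Qed.

Let gQ := (EFin \o g) \_ Q.

Let gQ_integrable : (mu \x mu)%E.-integrable setT gQ.
Proof.
by apply: (integrable_mkcond _ _).1 lipschitz_rectangle_integrable.
Qed.

Let RintegralQ :
  \int[(mu \x mu)%E]_(p in Q) g p = fine (\int[(mu \x mu)%E]_p gQ p)%E.
Proof. by rewrite /Rintegral integral_mkcond. Qed.

Lemma lipschitz_rectangle_fubini :
  \int[(mu \x mu)%E]_(p in Q) g p =
    \int[mu]_(y in `[c, d]) \int[mu]_(x in `[a, b]) g (x, y) /\
  \int[(mu \x mu)%E]_(p in Q) g p =
    \int[mu]_(x in `[a, b]) \int[mu]_(y in `[c, d]) g (x, y).
Proof.
split; rewrite RintegralQ.
  rewrite -integral21_prod_meas1//; congr fine.
  rewrite [RHS]integral_mkcond; apply: eq_integral => y _.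
  rewrite patchE; case: ifPn => [|/negP ycd]; last first.
    apply: integral0_eq => x _; rewrite /gQ patchE; case: ifPn => //.
    by rewrite inE => -[_ /= h]; exfalso; apply: ycd; rewrite inE.
  rewrite inE/= => ycd.
  have ig := lipschitz_itv_integrable ab (ltW L0) (g1 ycd).
  rewrite fineK ?integrable_fin_num// [RHS]integral_mkcond.
  apply: eq_integral => x _; rewrite /gQ !patchE.
  by congr (if _ then _ else _); apply/idP/idP; rewrite !inE => // -[].
rewrite -integral12_prod_meas1//; congr fine.
rewrite [RHS]integral_mkcond; apply: eq_integral => x _.
rewrite patchE; case: ifPn => [|/negP xab]; last first.
  apply: integral0_eq => y _; rewrite /gQ patchE; case: ifPn => //.
  by rewrite inE => -[/= h _]; exfalso; apply: xab; rewrite inE.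
rewrite inE/= => xab.
have ig := lipschitz_itv_integrable cd (ltW L0) (g2 xab).
rewrite fineK ?integrable_fin_num// [RHS]integral_mkcond.
apply: eq_integral => y _; rewrite /gQ !patchE.
by congr (if _ then _ else _); apply/idP/idP; rewrite !inE => // -[].
Qed.

End rectangle.

(** * Partial derivatives and Lipschitz bounds *)

Section mean_value.
Context (R : realType).

Lemma is_derive_quotient (F : R -> R) (x l : R) :
  h^-1 * (F (x + h) - F x) @[h --> (0 : R)^'] --> l -> is_derive x 1 F l.
Proof.
move=> Fl.
have E : (fun h => h^-1 *: ((F \o shift x) (h *: 1) - F x)) =
    (fun h => h^-1 * (F (x + h) - F x)).
  by apply/funext => h /=; rewrite [_ *: 1]mulr1 [h + x]addrC.
split; first by rewrite /derivable E; apply/cvg_ex; exists l.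
by rewrite /derive E; exact: cvg_lim.
Qed.

Lemma mean_value_lipschitz (F dF : R -> R) (a b L : R) :
  (forall x, x \in `[a, b] ->
     h^-1 * (F (x + h) - F x) @[h --> (0 : R)^'] --> dF x) ->
  (forall x, x \in `[a, b] -> `|dF x| <= L) -> lipschitz_itv L a b F.
Proof.
move=> Fd dFL.
suff H x y : x \in `[a, b] -> y \in `[a, b] -> x <= y ->
    `|F y - F x| <= L * `|y - x|.
  move=> x y xab yab; have [xy|/ltW yx] := leP x y; last exact: H.
  by rewrite distrC [`|x - y|]distrC; exact: H.
move=> xab yab xy.
have sub z : z \in `[x, y] -> z \in `[a, b].
  move: xab yab; rewrite !in_itv/= => /andP[ax _] /andP[_ yb] /andP[xz zy].
  by rewrite (le_trans ax)// (le_trans zy).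
have Fder z : z \in `[x, y] -> is_derive z 1 F (dF z).
  by move=> /sub zab; apply: is_derive_quotient; exact: Fd.
have Fc : {within `[x, y], continuous F}.
  by apply: derivable_within_continuous => z /Fder [].
have Fd' z : z \in `]x, y[ -> is_derive z 1 F (dF z).
  by move=> zxy; apply: Fder; apply: subset_itv_oo_cc zxy.
have [z zxy ->] := MVT_segment xy Fd' Fc.
by rewrite normrM ler_wpM2r// dFL// sub.
Qed.

End mean_value.

Section C1_lipschitz.
Context (R : realType) (k : scalar_kind).
Notation K := (scalar_field R k).
Variables (a b c d : R) (Omega : set (R * R)).
Let Q := `[a, b] `*` `[c, d].
Hypothesis QO : Q `<=` Omega.

Lemma compact_scalar_bounded (g : R * R -> K) :
  {within Omega, continuous g} ->
  exists M, forall p, Q p -> `|scalar_re (g p)| <= M.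
Proof.
move=> cg.
have cQ : {within Q, continuous (fun p => scalar_re (g p))}.
  have := continuous_subspaceW QO cg.
  by move=> cgQ p; apply: scalar_re_cvg; exact: cgQ.
have kQ : compact ((fun p => scalar_re (g p)) @` Q).
  apply: continuous_compact => //.
  by apply: compact_setX; exact: segment_compact.
have [M [_ MQ]] := @compact_bounded R R _ kQ.
exists (M + 1) => p Qp; apply: (MQ (M + 1)); first by rewrite ltrDl.
by exists p.
Qed.

(** Applied to [u h = (p.1 + h, p.2)] and [u h = (p.1, p.2 + h)]. *)
Lemma scalar_re_partial (g : R * R -> K) (u : R -> R * R) (p : R * R) (l : K) :
  ((h : R)%:K)^-1 * (g (u h) - g p) @[h --> (0 : R)^'] --> l ->
  h^-1 * (scalar_re (g (u h)) - scalar_re (g p)) @[h --> (0 : R)^'] -->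
    scalar_re l.
Proof.
move=> /scalar_re_cvg; apply: cvg_trans; apply: near_eq_cvg.
apply: nearW => h; rewrite -scalar_ofV scalar_reZ; congr (_ * _).
by apply/eqP; rewrite eq_sym subr_eq -scalar_reD subrK.
Qed.

(** The constant bounds both partial derivatives, which are continuous on the
    compact rectangle. *)
Lemma C1_lipschitz (g : R * R -> K) :
  continuously_partially_differentiable Omega g ->
  exists2 L : R, 0 < L &
    (forall y, y \in `[c, d] ->
       lipschitz_itv L a b (fun x => scalar_re (g (x, y)))) /\
    (forall x, x \in `[a, b] ->
       lipschitz_itv L c d (fun y => scalar_re (g (x, y)))).
Proof.
move=> [g1 [g2 [gd /compact_scalar_bounded[M1 M1P]]]].
move=> /compact_scalar_bounded[M2 M2P].
exists (`|M1| + `|M2| + 1); first by rewrite ltr_wpDl.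
split=> [y ycd|x xab].
- apply: (@mean_value_lipschitz _ _ (fun x => scalar_re (g1 (x, y)))) => x xab.
    have [h _] := gd _ (QO (conj xab ycd : Q (x, y))).
    exact: (scalar_re_partial h).
  apply: le_trans (M1P _ (conj xab ycd : Q (x, y))) _.
  by have := ler_norm M1; have := normr_ge0 M2; lra.
- apply: (@mean_value_lipschitz _ _ (fun y => scalar_re (g2 (x, y)))) => y ycd.
    have [_ h] := gd _ (QO (conj xab ycd : Q (x, y))).
    exact: (scalar_re_partial h).
  apply: le_trans (M2P _ (conj xab ycd : Q (x, y))) _.
  by have := ler_norm M2; have := normr_ge0 M1; lra.
Qed.

End C1_lipschitz.

(** * Pettis integrals of weakly Lipschitz functions *)

Section pettis_by_real_functionals.
Context (R : realType) (k : scalar_kind).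
Notation K := (scalar_field R k).
Context (E : tvsType K) (d : measure_display) (T : measurableType d).
Context (mu : {measure set T -> \bar R}).
Implicit Types (A : set T) (h : T -> E) (v : E).

(** Real parts suffice because the imaginary part of [e' x] is the real part of
    [e' (- i x)]. *)
Lemma pettis_integrable_real A h v :
  (forall phi, real_functional phi ->
     mu.-integrable A (EFin \o (phi \o h)) /\
     phi v = \int[mu]_(x in A) phi (h x)) ->
  pettis_integrable mu A h.
Proof.
case: k E h v => [|] F h v hphi.
  have e'P (e' : {linear F -> (scalar_field R RealScalars)^o}) :
      continuous e' ->
      real_functional (e' : F -> R) by move=> ce'; exists e'.
  split=> [e' /e'P /hphi[]//|]; exists v => e' /e'P /hphi[_ e'v].
  exact: e'v.
pose C := scalar_field R ComplexScalars.
have ReP (e' : {linear F -> C^o}) : continuous e' ->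
    real_functional (fun x => complex.Re (e' x)) by move=> ce'; exists e'.
have ImP (e' : {linear F -> C^o}) : continuous e' ->
    real_functional (fun x => complex.Im (e' x)).
  move=> /ReP /(real_functional_rotate (- 'i%C : C)) re'.
  rewrite (_ : (fun x => _) =
    (fun x => complex.Re (e' ((- 'i%C : C) *: x)))) //.
  apply/funext => x; rewrite linearZ/=.
  by case: (e' x) => p q /=; ring.
split=> [e' ce'|].
  by split; [have [] := hphi _ (ReP _ ce')|have [] := hphi _ (ImP _ ce')].
exists v => e' ce'; apply/eqP; rewrite eq_complex; apply/andP; split; apply/eqP.
  by have [_] := hphi _ (ReP _ ce').
by have [_] := hphi _ (ImP _ ce').
Qed.

Lemma pettis_integral_real A h phi : pettis_integrable mu A h ->
  real_functional phi ->
  phi (pettis_integral mu A h) = \int[mu]_(x in A) phi (h x).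
Proof.
move=> [_ [v vP]] [e' ce' ->].
have := xgetPex 0 (ex_intro _ v vP); rewrite -/(pettis_integral mu A h).
move=> /(_ e' ce') ->.
by rewrite /scalar_integral /scalar_re; case: k E h e' ce' v vP.
Qed.

End pettis_by_real_functionals.

Section pettis_lebesgue.
Context (R : realType) (k : scalar_kind).
Notation K := (scalar_field R k).
Notation mu := (@lebesgue_measure R).
Context (E : tvsType K).
Hypothesis E_locally_complete : locally_complete E.

(** The integral is the limit of the Riemann sums. *)
Lemma pettis_integrable_lipschitz (a b : R) (h : R -> E) : a <= b ->
  (forall phi, real_functional phi ->
     exists2 L, 0 < L & lipschitz_itv L a b (phi \o h)) ->
  pettis_integrable mu `[a, b] h.
Proof.
move=> ab hL.
pose s (n : nat) : E := \sum_(i < n.+1) ((b - a) / n.+1%:R)%:K *: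
  h (a + i%:R * ((b - a) / n.+1%:R)).
have sE phi n : real_functional phi -> phi (s n) = \sum_(i < n.+1)
    (b - a) / n.+1%:R * phi (h (a + i%:R * ((b - a) / n.+1%:R))).
  move=> rphi; rewrite /s.
  rewrite (real_functional_sum _ (fun i : nat => ((b - a) / n.+1%:R)%:K *:
    h (a + i%:R * ((b - a) / n.+1%:R))) rphi).
  by apply: eq_bigr => i _; rewrite real_functionalZ.
have sL phi : real_functional phi -> exists2 M, 0 <= M &
    forall n,
      `|\int[mu]_(x in `[a, b]) phi (h x) - phi (s n)| <= M * n.+1%:R^-1.
  move=> rphi; have [L L0 hLip] := hL _ rphi.
  exists (L * (b - a) ^+ 2); first by rewrite mulr_ge0 ?sqr_ge0// ltW.
  by move=> n; rewrite sE//; exact: (riemann_sum_error n ab (ltW L0) hLip).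
have sC : weakly_fast_cauchy s.
  move=> phi rphi; have [M M0 sM] := sL _ rphi; exists M => n m.
  rewrite real_functionalB//; set I := \int[mu]_(x in `[a, b]) phi (h x) in sM.
  rewrite (_ : phi (s n) - phi (s m) = (I - phi (s m)) - (I - phi (s n))).
    by rewrite mulrDr [leRHS]addrC (le_trans (ler_normB _ _))// lerD.
  by ring.
have [v vP] := weakly_fast_cauchy_cvg E_locally_complete sC.
apply: (@pettis_integrable_real _ _ _ _ _ _ _ _ v) => phi rphi; split.
  have [L L0 hLip] := hL _ rphi.
  exact: lipschitz_itv_integrable ab (ltW L0) hLip.
have [M M0 sM] := sL _ rphi.
apply: (@cvg_unique _ (@Rhausdorff R) _ _ _ _ (vP _ rphi)).
apply/cvgrPdist_lt => e e0.
have eM : 0 < e / (M + 1) by rewrite divr_gt0// ltr_wpDl.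
have := near_infty_natSinv_lt (PosNum eM); apply: filterS => n /= ne.
apply: le_lt_trans (sM n) _; apply: (@le_lt_trans _ _ ((M + 1) * n.+1%:R^-1)).
  by rewrite ler_wpM2r// lerDl.
by rewrite mulrC -ltr_pdivlMr// ltr_wpDl.
Qed.

(** A functional sends [I y - I y'] to the integral over [[a, b]] of a function
    bounded by [L |y - y'|]; so [I] is again weakly Lipschitz. *)
Lemma pettis_iterated (a b c d : R) (F : R -> R -> E) : a <= b -> c <= d ->
  (forall phi, real_functional phi -> exists2 L, 0 < L &
     (forall y, y \in `[c, d] -> lipschitz_itv L a b (fun x => phi (F x y))) /\
     (forall x, x \in `[a, b] -> lipschitz_itv L c d (fun y => phi (F x y)))) ->
  let I y := pettis_integral mu `[a, b] (fun x => F x y) in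
  [/\ forall y, y \in `[c, d] ->
        pettis_integrable mu `[a, b] (fun x => F x y),
      pettis_integrable mu `[c, d] I &
      forall phi, real_functional phi ->
        phi (pettis_integral mu `[c, d] I) =
        \int[mu]_(y in `[c, d]) \int[mu]_(x in `[a, b]) phi (F x y)].
Proof.
move=> ab cd FL I.
have Fi y : y \in `[c, d] -> pettis_integrable mu `[a, b] (fun x => F x y).
  move=> ycd; apply: pettis_integrable_lipschitz => // phi rphi.
  by have [L L0 [L1 _]] := FL _ rphi; exists L => //; exact: L1.
have IE phi y : real_functional phi -> y \in `[c, d] ->
    phi (I y) = \int[mu]_(x in `[a, b]) phi (F x y).
  by move=> rphi ycd; rewrite pettis_integral_real//; exact: Fi.
have Ii : pettis_integrable mu `[c, d] I.
  apply: pettis_integrable_lipschitz => // phi rphi.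
  have [L L0 [L1 L2]] := FL _ rphi.
  (* [+ 1] keeps the constant positive when [a = b] *)
  exists (L * (b - a) + 1).
    by rewrite ltr_wpDl// mulr_ge0 ?subr_ge0// ltW.
  move=> y y' ycd y'cd; rewrite /= !IE//.
  have iy := lipschitz_itv_integrable ab (ltW L0) (L1 _ ycd).
  have iy' := lipschitz_itv_integrable ab (ltW L0) (L1 _ y'cd).
  have muab : mu `[a, b] = (b - a)%:E.
    by rewrite lebesgue_measure_itv/= lte_fin -EFinB; case: ltP => // ba;
      congr EFin; lra.
  have xL x : `[a, b]%classic x ->
      `|phi (F x y) - phi (F x y')| <= L * `|y - y'|.
    by move=> xab; exact: L2.
  apply: le_trans (Rintegral_dist _ muab iy iy' xL) _ => //.
  by rewrite mulrAC ler_wpM2r// lerDl.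
split => // phi rphi; rewrite pettis_integral_real//.
by apply: eq_Rintegral => y; rewrite inE => ycd; exact: IE.
Qed.

End pettis_lebesgue.

(** * Fubini's theorem *)

Theorem theorem4p4 (R : realType) (k : scalar_kind)
    (E : tvsType (scalar_field R k))
    (E_nontrivial : exists v : E, v != 0)
    (E_hausdorff : hausdorff_space E)
    (E_locally_complete : locally_complete E)
    (Omega : set (R * R)) (Omega_open : open Omega)
    (a b c d : R) (ab : a <= b) (cd : c <= d)
    (rect_Omega : `[a, b] `*` `[c, d] `<=` Omega)
    (f : R * R -> E) (f_C1 : weakly_C1 Omega f) :
  let mu := @lebesgue_measure R in
  let I1 x2 := pettis_integral mu `[a, b] (fun x1 => f (x1, x2)) in
  let I2 x1 := pettis_integral mu `[c, d] (fun x2 => f (x1, x2)) in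
  [/\ pettis_integrable (mu \x mu)%E (`[a, b] `*` `[c, d]) f,
      (forall x2, x2 \in `[c, d] ->
         pettis_integrable mu `[a, b] (fun x1 => f (x1, x2))) /\
      pettis_integrable mu `[c, d] I1,
      (forall x1, x1 \in `[a, b] ->
         pettis_integrable mu `[c, d] (fun x2 => f (x1, x2))) /\
      pettis_integrable mu `[a, b] I2,
      pettis_integral (mu \x mu)%E (`[a, b] `*` `[c, d]) f =
      pettis_integral mu `[c, d] I1 &
      pettis_integral mu `[c, d] I1 = pettis_integral mu `[a, b] I2].
Proof.
move=> mu I1 I2.
have fL phi : real_functional phi -> exists2 L, 0 < L &
    (forall y, y \in `[c, d] ->
       lipschitz_itv L a b (fun x => phi (f (x, y)))) /\
    (forall x, x \in `[a, b] ->
       lipschitz_itv L c d (fun y => phi (f (x, y)))).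
  move=> [e' ce' ->].
  by have := C1_lipschitz rect_Omega (f_C1 _ ce'); apply.
have [f1 I1i I1E] :=
  pettis_iterated E_locally_complete (F := fun x y => f (x, y)) ab cd fL.
have fL' phi : real_functional phi -> exists2 L, 0 < L &
    (forall x, x \in `[a, b] ->
       lipschitz_itv L c d (fun y => phi (f (x, y)))) /\
    (forall y, y \in `[c, d] ->
       lipschitz_itv L a b (fun x => phi (f (x, y)))).
  by move=> /fL[L L0 [L1 L2]]; exists L.
have [f2 I2i I2E] :=
  pettis_iterated E_locally_complete (F := fun y x => f (x, y)) cd ab fL'.
have fubini phi : real_functional phi ->
    \int[(mu \x mu)%E]_(p in `[a, b] `*` `[c, d]) phi (f p) =
      phi (pettis_integral mu `[c, d] I1) /\
    \int[(mu \x mu)%E]_(p in `[a, b] `*` `[c, d]) phi (f p) =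
      phi (pettis_integral mu `[a, b] I2).
  move=> rphi; have [L L0 [L1 L2]] := fL _ rphi; rewrite I1E// I2E//.
  exact: (lipschitz_rectangle_fubini (g := phi \o f) ab cd L0 L1 L2).
have fi : pettis_integrable (mu \x mu)%E (`[a, b] `*` `[c, d]) f.
  apply: (pettis_integrable_real (v := pettis_integral mu `[c, d] I1)).
  move=> phi rphi; split; last by rewrite (fubini _ rphi).1.
  have [L L0 [L1 L2]] := fL _ rphi.
  exact: (lipschitz_rectangle_integrable (g := phi \o f) ab cd L0 L1 L2).
split=> //; apply: real_functional_separates => // phi rphi.
  by rewrite pettis_integral_real// (fubini _ rphi).1.
by rewrite -(fubini _ rphi).1 (fubini _ rphi).2.
Qed.
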